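(* Let $A$ be a (complex) Banach algebra, let $\varphi\in Hom(A,\mathbb{C})$, and let $X$ be a linear, closed, $A$-left invariant subspace of $A^\ast$ such that $Hom(A,\mathbb{C})\subseteq X$. Suppose $P:A^\ast\rightarrow X$ is a continuous linear map such that $P(Hom(A,\mathbb{C}))\subseteq Hom(A,\mathbb{C})$ and $P(f\cdot a)=P(f)\cdot a$ for every $f\in A^\ast$ and $a\in A$. Then $X$ is $\varphi$-left amenable if and only if $A$ is $\varphi$-amenable.
   Context: $A^\ast$ is the Banach space dual of $A$, and $Hom(A,\mathbb{C})$ is the set of all nonzero homomorphisms (characters) from $A$ into $\mathbb{C}$; it is a subset of $A^\ast$. For $f\in A^\ast$ and $a\in A$, $f\cdot a\in A^\ast$ is defined by $\langle f\cdot a,b\rangle=\langle f,ab\rangle$ for $b\in A$. A subspace $X\subseteq A^\ast$ is $A$-left invariant if $X\cdot A\subseteq X$, i.e. $f\cdot a\in X$ for all $f\in X$, $a\in A$. For a linear, closed, $A$-left invariant subspace $X$ of $A^\ast$ with $Hom(A,\mathbb{C})\subseteq X$ and $\varphi\in Hom(A,\mathbb{C})$, $X$ is called $\varphi$-left amenable if there exists $m_\varphi\in X^\ast$ such that (i) $m_\varphi(\varphi)=1$ and (ii) $m_\varphi(f\cdot a)=\varphi(a)m_\varphi(f)$ for every $f\in X$ and $a\in A$. The Banach algebra $A$ is called $\varphi$-amenable if $A^\ast$ is $\varphi$-left amenable. *)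

(* Defs.v *)
From HB Require Import structures.
From mathcomp Require Import all_boot all_order all_algebra.
From mathcomp Require Import complex ring.
From mathcomp Require Import all_classical all_reals all_analysis.

Set Implicit Arguments.
Unset Strict Implicit.
Unset Printing Implicit Defensive.

Import Order.TTheory GRing.Theory Num.Theory.
Import numFieldNormedType.Exports.
Import Normc.

Local Open Scope classical_set_scope.
Local Open Scope complex_scope.
Local Open Scope ring_scope.

(* Not necessarily unital, so the product cannot be a [pzRingType] one. *)
HB.mixin Record CompleteNormedModule_isBanachAlgebra (K : numFieldType) A
    & CompleteNormedModule K A := {
  bmul : A -> A -> A;
  bmulA : associative bmul;
  bmulDl : left_distributive bmul +%R;
  bmulDr : right_distributive bmul +%R;
  bmulZl : forall (k : K) (a b : A), bmul (k *: a) b = k *: bmul a b;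
  bmulZr : forall (k : K) (a b : A), bmul a (k *: b) = k *: bmul a b;
  bmul_norm_le : forall a b : A, `|bmul a b| <= `|a| * `|b|
}.

#[short(type="banachAlgType")]
HB.structure Definition BanachAlgebra (K : numFieldType) :=
  {A of CompleteNormedModule K A & CompleteNormedModule_isBanachAlgebra K A}.

Reserved Notation "a *b b" (at level 40, left associativity).
Notation "a *b b" := (bmul a b) : ring_scope.

Section Dual.
Context {R : realType} (V : normedModType R[i]).

Definition dual_pred : {pred V -> R[i]^o} :=
  [in [set f : V -> R[i]^o | linear f /\ continuous f]].

Record dual := Dual { dual_fun :> V -> R[i]^o ; _ : dual_fun \in dual_pred }.

HB.instance Definition _ := [isSub for dual_fun].
HB.instance Definition _ := [Choice of dual by <:].

Lemma dualP (f : dual) : linear f /\ continuous f.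
Proof. by case: f => f /= /set_mem. Qed.

Lemma dual_ext (f g : dual) : f =1 g -> f = g.
Proof. by move=> fg; apply/val_inj/funext. Qed.

HB.instance Definition _ (f : dual) :=
  GRing.isLinear.Build R[i] V R[i]^o *:%R f (dualP f).1.

Lemma dual_continuous (f : dual) : continuous f.
Proof. by case: (dualP f). Qed.

Lemma dual_submod_closed : submod_closed dual_pred.
Proof.
split=> [|k f g /set_mem[lf cf] /set_mem[lg cg]]; apply/mem_set; split.
- by move=> k u v; rewrite /= scaler0 addr0.
- exact: cst_continuous.
- move=> l u v.
  apply: etrans (_ : k * f (l *: u + v) + g (l *: u + v) = _); first by [].
  rewrite lf lg.
  apply: etrans (_ : _ = l * (k * f u + g u) + (k * f v + g v)) _; last by [].
  by rewrite /GRing.scale /=; ring.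
- move=> x; apply: (@continuousD _ _ _ (k \*: f) g x); last exact: cg.
  exact/continuousZr/cf.
Qed.

HB.instance Definition _ :=
  GRing.isSubmodClosed.Build R[i] (V -> R[i]^o) dual_pred dual_submod_closed.
HB.instance Definition _ := [SubChoice_isSubLmodule of dual by <:].

Lemma dual_addE (f g : dual) x : (f + g) x = f x + g x. Proof. by []. Qed.

Lemma dual_scaleE k (f : dual) x : (k *: f) x = k * f x. Proof. by []. Qed.

Lemma dual_zeroE x : (0 : dual) x = 0. Proof. by []. Qed.

(* The norm of a complex number is an element of [R[i]] in MathComp; [normc] is
   its [R]-valued version, where suprema exist. *)
Definition opnorm (f : dual) : R :=
  sup [set normc (f x) | x in [set x : V | `|x| <= 1]].

Lemma normcE' (z : R[i]) : `|z| = (normc z)%:C. Proof. by []. Qed.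

Lemma opnorm_has_sup (f : dual) :
  has_sup [set normc (f x) | x in [set x : V | `|x| <= 1]].
Proof.
split; first by exists (normc (f 0)), 0 => //=; rewrite normr0.
have /linear_boundedP/pinfty_ex_gt0[M M0 fM] : bounded_near f (nbhs 0).
  exact/linear_bounded_continuous/dual_continuous.
exists (complex.Re M) => _ [x /= x1 <-].
rewrite -lecR -normcE'.
have -> : (complex.Re M)%:C = M.
  move: M0; rewrite ltcE => /andP[/eqP /= M0 _].
  by apply/eqP; rewrite eq_complex /= M0 !eqxx.
by rewrite (le_trans (fM x))// ger_pMr.
Qed.

Lemma opnorm_ub (f : dual) x : `|x| <= 1 -> normc (f x) <= opnorm f.
Proof.
by move=> x1; apply: (sup_upper_bound (opnorm_has_sup f)); exists x.
Qed.

Lemma opnorm_le (f : dual) M :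
  (forall x, `|x| <= 1 -> normc (f x) <= M) -> opnorm f <= M.
Proof.
move=> fM; apply: ge_sup; first by case: (opnorm_has_sup f).
by move=> _ [x x1 <-]; exact: fM.
Qed.

Definition dual_norm (f : dual) : R[i] := (opnorm f)%:C.

Lemma dual_ler_normD f g : dual_norm (f + g) <= dual_norm f + dual_norm g.
Proof.
rewrite -rmorphD lecR; apply: opnorm_le => x x1.
by rewrite dual_addE (le_trans (le_normcD _ _))// lerD// opnorm_ub.
Qed.

Lemma opnormZ_le k f : opnorm (k *: f) <= normc k * opnorm f.
Proof.
apply: opnorm_le => x x1; rewrite dual_scaleE normcM ler_wpM2l ?opnorm_ub//.
by rewrite -lecR -normcE' normr_ge0.
Qed.

Lemma dual_normrZ k f : dual_norm (k *: f) = `|k| * dual_norm f.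
Proof.
rewrite normcE' -rmorphM /dual_norm; congr (_%:C).
apply/eqP; rewrite eq_le opnormZ_le /=.
have [->|k0] := eqVneq k 0.
  rewrite normc0 mul0r -(normc0 R) -[X in normc X](dual_zeroE 0) -(scale0r f).
  by apply: opnorm_ub; rewrite normr0.
have nk0 : 0 < normc k by rewrite -ltcR -normcE' normr_gt0.
rewrite -ler_pdivlMl// -normcV (le_trans _ (opnormZ_le _ _))//.
by rewrite scalerA mulVf// scale1r.
Qed.

Lemma dual_normr0_eq0 f : dual_norm f = 0 -> f = 0.
Proof.
move=> /eqP; rewrite eq_complex /= eqxx andbT => /eqP f0.
apply: dual_ext => x; rewrite dual_zeroE.
have [->|x0] := eqVneq x 0; first by rewrite linear0.
have nx : `| `|x|^-1 *: x| <= 1 by rewrite normfZV.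
have := opnorm_ub f nx; rewrite f0 linearZ /= -lecR -normcE' normr_le0.
by rewrite mulf_eq0 invr_eq0 normr_eq0 (negPf x0) => /eqP.
Qed.

HB.instance Definition _ := Lmodule_isNormed.Build R[i] dual
  dual_ler_normD dual_normrZ dual_normr0_eq0.

End Dual.

Notation "V ^*d" := (dual V) (at level 2, format "V ^*d") : type_scope.

Record closedSubspace (K : numFieldType) (V : normedModType K) :=
  ClosedSubspace {
    csub_set :> set V ;
    csub_submod : submod_closed [in csub_set] ;
    csub_closed : closed csub_set
  }.

(* [X] as a normed space in its own right, with the norm of [V]; [csub X] rather
   than [set_type X], whose topology in the library is not built from a norm. *)
Section Subspace.
Context {K : numFieldType} {V : normedModType K}.

Definition csub_pred (X : closedSubspace V) : {pred V} := [in csub_set X].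

Record csub (X : closedSubspace V) :=
  CSub { csub_val : V ; csub_valP : csub_val \in csub_pred X }.

Variable X : closedSubspace V.

HB.instance Definition _ := [isSub of csub X for @csub_val X].
HB.instance Definition _ := [Choice of csub X by <:].
HB.instance Definition _ :=
  GRing.isSubmodClosed.Build K V (csub_pred X) (csub_submod X).
HB.instance Definition _ := [SubChoice_isSubLmodule of csub X by <:].

Definition csub_norm (x : csub X) : K := `|csub_val x|.

Lemma csub_ler_normD x y : csub_norm (x + y) <= csub_norm x + csub_norm y.
Proof. exact: ler_normD. Qed.

Lemma csub_normrZ k x : csub_norm (k *: x) = `|k| * csub_norm x.
Proof. exact: normrZ. Qed.

Lemma csub_normr0_eq0 x : csub_norm x = 0 -> x = 0.
Proof. by move=> /normr0_eq0 x0; apply: val_inj. Qed.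

HB.instance Definition _ := Lmodule_isNormed.Build K (csub X)
  csub_ler_normD csub_normrZ csub_normr0_eq0.

End Subspace.

Section FullSubspace.
Context {K : numFieldType} (V : normedModType K).

Lemma setT_submod_closed : submod_closed [in [set: V]].
Proof. by split=> [|k u v _ _]; exact: mem_set. Qed.

Definition full_csub : closedSubspace V :=
  ClosedSubspace setT_submod_closed closedT.

End FullSubspace.

Section DualAction.
Context {R : realType} {A : banachAlgType R[i]}.

Lemma bmul_continuous (a : A) : continuous (bmul a).
Proof.
have la : linear (bmul a) by move=> k u v; rewrite bmulDr bmulZr.
pose h : {linear A -> A} := HB.pack (bmul a) (GRing.isLinear.Build _ _ _ _ _ la).
apply: (@linear_bounded_continuous _ _ _ h).1; apply/linear_boundedP.
exists `|a|; split=> [|r /ltW ar x]; first exact: normr_real.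
by rewrite (le_trans (bmul_norm_le a x))// ler_wpM2r.
Qed.

Lemma dact_subproof (f : A^*d) (a : A) :
  (fun b => f (a *b b)) \in @dual_pred R A.
Proof.
apply/mem_set; split=> [k u v|x].
  by rewrite bmulDr bmulZr linearP.
by apply: continuous_comp; [exact: bmul_continuous|exact: dual_continuous].
Qed.

Definition dact (f : A^*d) (a : A) : A^*d := Dual (dact_subproof f a).

End DualAction.

(* Hom(A, C), as a subset of A^*: homomorphisms from a Banach algebra to the
   complex numbers are automatically continuous. *)
Definition characters (R : realType) (A : banachAlgType R[i]) : set A^*d :=
  [set f : A^*d | f <> 0 /\ forall a b : A, f (a *b b) = f a * f b].
Arguments characters {R} A.

Definition left_invariant (R : realType) (A : banachAlgType R[i])
    (X : set A^*d) : Prop :=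
  forall f a, X f -> X (dact f a).

Section LeftAmenable.
Context {R : realType} {A : banachAlgType R[i]}.

Definition csub_act (X : closedSubspace A^*d) (Xinv : left_invariant X)
    (f : csub X) (a : A) : csub X :=
  CSub (mem_set (Xinv (csub_val f) a (set_mem (csub_valP f)))).

Definition csub_char (X : closedSubspace A^*d) (XHom : characters A `<=` X)
    (phi : A^*d) (phiP : characters A phi) : csub X :=
  CSub (mem_set (XHom phi phiP)).

Definition left_amenable (X : closedSubspace A^*d) (Xinv : left_invariant X)
    (XHom : characters A `<=` X) (phi : A^*d) (phiP : characters A phi) : Prop :=
  exists m : (csub X)^*d,
    m (csub_char XHom phiP) = 1 /\
    forall f a, m (csub_act Xinv f a) = phi a * m f.

Lemma full_left_invariant : left_invariant (full_csub A^*d).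
Proof. by []. Qed.

Definition char_amenable (phi : A^*d) (phiP : characters A phi) : Prop :=
  left_amenable full_left_invariant (@subsetT _ (characters A)) phiP.

End LeftAmenable.

(* Main.v *)
(* An A-module map [P] fixes every character that it sends to a character: if
   [psi = P phi], applying [P] to [phi . a = phi(a) phi] gives
   [psi(a) psi = phi(a) psi], hence [psi = phi].  So a mean on [X] pulls back
   along [P] to a mean on the dual of A; conversely, means restrict to [X]. *)
Require Import Defs.
From HB Require Import structures.
From mathcomp Require Import all_boot all_order all_algebra.
From mathcomp Require Import complex.
From mathcomp Require Import all_classical all_reals all_analysis.

Set Implicit Arguments.
Unset Strict Implicit.
Unset Printing Implicit Defensive.

Import Order.TTheory GRing.Theory Num.Theory.
Import numFieldNormedType.Exports.

Local Open Scope classical_set_scope.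
Local Open Scope complex_scope.
Local Open Scope ring_scope.

(** Serves the two isometries below: [csub X] carries the norm of the ambient space, so both bounds
    hold with equality. *)
Lemma linear_contraction_continuous (K : numFieldType)
    (V W : normedModType K) (f : V -> W) :
  linear f -> (forall x, `|f x| <= `|x|) -> continuous f.
Proof.
move=> lf f_le.
pose h : {linear V -> W} :=
  HB.pack f (GRing.isLinear.Build _ _ _ _ _ lf).
apply: (@linear_bounded_continuous _ _ _ h).1; apply/linear_boundedP.
(* The bound is demanded for every constant [r] above the witness. *)
exists 1; split=> [|r /ltW r1 x]; first exact: real1.
by rewrite (le_trans (f_le x))// ler_peMl.
Qed.

Lemma csub_val_continuous (K : numFieldType) (V : normedModType K)
    (X : closedSubspace V) : continuous (@csub_val K V X).
Proof. exact: linear_contraction_continuous. Qed.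

Section DualComp.
Context {R : realType} (V W : normedModType R[i]) (T : V -> W).
Hypotheses (Tlin : linear T) (Tcont : continuous T).

Lemma dual_comp_subproof (g : W^*d) : (g \o T) \in @dual_pred R V.
Proof.
apply/mem_set; split=> [k u v|x]; first by rewrite /= Tlin linearP.
by apply: continuous_comp; [exact: Tcont|exact: dual_continuous].
Qed.

(** The adjoint of [T]; means are transported along it in both directions. *)
Definition dual_comp (g : W^*d) : V^*d := Dual (dual_comp_subproof g).

End DualComp.

Section FullInclusion.
Context {K : numFieldType} {V : normedModType K} (X : closedSubspace V).

(** A mean on the whole dual has as domain the copy [csub (full_csub V)] of [V], so restricting it
    to [X] means composing with this inclusion. *)
Definition csub_full (x : csub X) : csub (full_csub V) :=
  @CSub _ _ (full_csub V) (csub_val x) (mem_set I).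

Lemma csub_full_linear : linear csub_full.
Proof. by move=> k u v; apply: val_inj. Qed.

Lemma csub_full_continuous : continuous csub_full.
Proof. exact: linear_contraction_continuous csub_full_linear _. Qed.

End FullInclusion.

Section Characters.
Context {R : realType} {A : banachAlgType R[i]}.

Lemma dact_character (phi : A^*d) (a : A) :
  characters A phi -> dact phi a = phi a *: phi.
Proof. by move=> [_ phiM]; apply: dual_ext => b; rewrite dual_scaleE -phiM. Qed.

(** A nonzero vector has only one eigenvalue: [psi] is also scaled by [psi a], so
    [(psi a - phi a) *: psi] vanishes while [psi] does not. *)
Lemma character_eigen_eq (phi psi : A^*d) :
  characters A psi -> (forall a, dact psi a = phi a *: psi) -> psi = phi.
Proof.
move=> psiP psi_eigen; apply: dual_ext => a.
have /eqP := psi_eigen a; rewrite dact_character// -subr_eq0 -scalerBl.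
by rewrite scaler_eq0 subr_eq0 => /orP[/eqP//|/eqP /psiP.1].
Qed.

End Characters.

Theorem theorem3p1 (R : realType) (A : banachAlgType R[i])
    (phi : A^*d) (phiP : characters A phi)
    (X : closedSubspace A^*d) (Xinv : left_invariant X)
    (XHom : characters A `<=` X)
    (P : {linear A^*d -> csub X}) (Pcont : continuous P)
    (PHom : forall psi : A^*d, characters A psi -> characters A (csub_val (P psi)))
    (Pact : forall (f : A^*d) (a : A), P (dact f a) = csub_act Xinv (P f) a) :
  left_amenable Xinv XHom phiP <-> char_amenable phiP.
Proof.
split=> -[m [m1 mact]].
  have PphiE : csub_val (P phi) = phi.
    apply: character_eigen_eq => [|a]; first exact: PHom.
    have /(congr1 (@csub_val _ _ X)) := Pact phi a.
    by rewrite dact_character// linearZ => /esym.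
  have Tlin : linear (P \o @csub_val _ _ (full_csub A^*d)).
    by move=> k u v; rewrite /= linearP.
  have Tcont : continuous (P \o @csub_val _ _ (full_csub A^*d)).
    move=> u; apply: continuous_comp; [exact: csub_val_continuous|exact: Pcont].
  exists (dual_comp Tlin Tcont m); split=> [|f a] /=.
    (* On underlying functionals the remaining equation is [PphiE]. *)
    by rewrite -m1; congr (m _); exact: val_inj.
  by rewrite Pact mact.
exists (dual_comp (@csub_full_linear _ _ X) (@csub_full_continuous _ _ X) m).
split=> [|f a] /=.
  by rewrite -m1; congr (m _); exact: val_inj.
(* The actions on [csub X] and on the full copy have the same underlying functional [dact]. *)
by rewrite -mact; congr (m _); exact: val_inj.
Qed.
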